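(* Let $\alpha,\beta\ge-1$ be fixed. For growth functions $\Phi,\Psi$ put $$C_{\min}(\Phi,\Psi)=\sup_{t>0}\frac{\Phi^{-1}(t^{2+\alpha})}{\Psi^{-1}(t^{2+\beta})},$$ and let $\mathcal{F}$ be the set of pairs $(\Phi,\Psi)$ of growth functions for which there exists $C>0$ such that $\Phi^{-1}(t^{2+\alpha})\le C\,\Psi^{-1}(t^{2+\beta})$ for all $t>0$. Let $(\Phi_0,\Psi_0),(\Phi_1,\Psi_1)\in\mathcal{F}$, and for $\theta\in[0,1]$ define $\Phi_\theta,\Psi_\theta$ by $$\Phi_\theta^{-1}(t)=\Phi_0^{-1}(t)^{1-\theta}\,\Phi_1^{-1}(t)^{\theta},\qquad \Psi_\theta^{-1}(t)=\Psi_0^{-1}(t)^{1-\theta}\,\Psi_1^{-1}(t)^{\theta}.$$ Then $$C_{\min}(\Phi_\theta,\Psi_\theta)\le C_{\min}(\Phi_0,\Psi_0)^{1-\theta}\,C_{\min}(\Phi_1,\Psi_1)^{\theta}.$$ Thus $\log C_{\min}$ is convex along such interpolations, i.e. $\theta\mapsto\log C_{\min}(\Phi_\theta,\Psi_\theta)$ is a convex function on $[0,1]$.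
   Context: A growth function is an increasing function $\Phi:[0,\infty)\to[0,\infty)$ with $\Phi(0)=0$ and $\Phi(t)\to\infty$ as $t\to\infty$. The growth functions whose inverse is used are assumed to be bijections of $[0,\infty)$, i.e. strictly increasing and continuous. $\Phi_\theta$ (resp. $\Psi_\theta$) denotes the growth function whose inverse is the function given by the displayed formula. *)

(* Defs.v *)
From mathcomp Require Import all_boot all_order all_algebra.
From mathcomp Require Import all_classical all_reals all_analysis.

Set Implicit Arguments.
Unset Strict Implicit.
Unset Printing Implicit Defensive.

Import Order.TTheory GRing.Theory Num.Theory.
Import numFieldNormedType.Exports.

Local Open Scope classical_set_scope.
Local Open Scope ring_scope.

(* A function on [0, +oo[ is represented by a function R -> R whose values    *)
(* outside [0, +oo[ are irrelevant.                                           *)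
Definition growth_function (R : realType) (Phi : R -> R) : Prop :=
  [/\ forall t, 0 <= t -> 0 <= Phi t,
      {in `[0, +oo[ &, {homo Phi : s t / s <= t}},
      Phi 0 = 0 &
      Phi t @[t --> +oo] --> +oo].

(* For an increasing Phi, bijectivity on [0, +oo[ amounts to strict           *)
(* monotonicity together with continuity.                                     *)
Definition invertible_growth (R : realType) (Phi : R -> R) : Prop :=
  growth_function Phi /\ set_bij `[0, +oo[ `[0, +oo[ Phi.

Definition ginv (R : realType) (Phi : R -> R) : R -> R :=
  'pinv_(fun=> 0) `[0, +oo[%classic Phi.

Definition Cmin (R : realType) (alpha beta : R) (Phi Psi : R -> R) : \bar R :=
  ereal_sup [set (ginv Phi (t `^ (2 + alpha)) / ginv Psi (t `^ (2 + beta)))%:E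
            | t in `]0, +oo[].

Definition Fpairs (R : realType) (alpha beta : R) : set ((R -> R) * (R -> R)) :=
  [set P | [/\ invertible_growth P.1, invertible_growth P.2 &
    exists2 C : R, 0 < C & forall t, 0 < t ->
      ginv P.1 (t `^ (2 + alpha)) <= C * ginv P.2 (t `^ (2 + beta))]].

Definition geo_mean (R : realType) (theta : R) (f0 f1 : R -> R) : R -> R :=
  fun t => f0 t `^ (1 - theta) * f1 t `^ theta.

(* Phi_theta is obtained by inverting the prescribed inverse; [ginv_interp]   *)
(* and [invertible_growth_interp] below state that it is indeed a growth      *)
(* function with that inverse.                                                *)
Definition interp (R : realType) (Phi0 Phi1 : R -> R) (theta : R) : R -> R :=
  ginv (geo_mean theta (ginv Phi0) (ginv Phi1)).

Section well_defined.
Variable R : realType.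
Implicit Types f g h : R -> R.

Let mbij f := set_bij `[0, +oo[ `[0, +oo[ f /\
  {in `[0, +oo[ &, {homo f : s t / s <= t}}.

Let in0y (x : R) : (x \in `[0, +oo[) = (0 <= x).
Proof. by rewrite in_itv/= andbT. Qed.

Let mbij_ge0 f t : mbij f -> 0 <= t -> 0 <= f t.
Proof.
move=> [[ff _ _] _] t0; have : `[0, +oo[%classic (f t).
  by apply: ff => /=; rewrite in0y.
by rewrite /= in0y.
Qed.

Let mbij_inj f s t : mbij f -> 0 <= s -> 0 <= t -> f s = f t -> s = t.
Proof.
by move=> [[_ fi _] _] s0 t0 e; apply: fi => //; rewrite inE/= in0y.
Qed.

Let mbij_mono f : mbij f -> {in `[0, +oo[ &, {mono f : s t / s <= t}}.
Proof.
move=> fb; have [_ fh] := fb.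
apply: le_mono_in => s t sA tA st; rewrite lt_neqAle fh ?ltW// andbT.
apply: contraTneq st => /(mbij_inj fb); rewrite -!in0y => /(_ sA tA) ->.
by rewrite ltxx.
Qed.

Let ginvK f t : mbij f -> 0 <= t -> f (ginv f t) = t.
Proof.
move=> [[_ _ fs] _] t0; apply: (surjpK _ fs); by rewrite inE/= in0y.
Qed.

Let fK f t : mbij f -> 0 <= t -> ginv f (f t) = t.
Proof.
move=> [[_ fi _] _] t0; apply: pinvKV => //; by rewrite inE/= in0y.
Qed.

Let ginv_mbij f : mbij f -> mbij (ginv f).
Proof.
move=> fb; have [fbij _] := fb.
have gbij : set_bij `[0, +oo[ `[0, +oo[ (ginv f) by exact: bijpinv_bij.
split=> // s t; rewrite !in0y => s0 t0 st.
have g0 u : 0 <= u -> 0 <= ginv f u.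
  move=> u0; case: gbij => gf _ _; have := gf u; rewrite /= !in0y; exact.
by rewrite -(mbij_mono fb) ?in0y ?g0// !ginvK.
Qed.

Let mbij0 f : mbij f -> f 0 = 0.
Proof.
move=> fb; apply/eqP; rewrite eq_le (mbij_ge0 fb)// andbT.
have g0 : 0 <= ginv f 0 by exact: mbij_ge0 (ginv_mbij fb) _.
by rewrite -[leRHS](ginvK fb)//; have [_] := fb; apply; rewrite ?in0y.
Qed.

Let mbij_invertible f : mbij f <-> invertible_growth f.
Proof.
split; last by move=> [[_ ? _ _] ?].
move=> fb; have [fbij fh] := fb; split=> //; split=> //.
- by move=> t; exact: mbij_ge0.
- exact: mbij0.
apply/cvgryPge => A; near=> t.
have A0 : 0 <= Num.max A 0 by rewrite le_max lexx orbT.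
apply: (@le_trans _ _ (Num.max A 0)); first by rewrite le_max lexx.
rewrite -(ginvK fb A0); apply: fh; rewrite ?in0y.
- exact: mbij_ge0 (ginv_mbij fb) _.
- by near: t; apply: nbhs_pinfty_ge; rewrite num_real.
- by near: t; apply: nbhs_pinfty_ge; rewrite num_real.
Unshelve. all: by end_near. Qed.

Let ginv_ginv f t : mbij f -> 0 <= t -> ginv (ginv f) t = f t.
Proof.
move=> fb t0; rewrite -[in LHS](fK fb t0) fK//; last exact: mbij_ge0.
exact: ginv_mbij.
Qed.

Let geo_mean_le theta f0 f1 s t : 0 <= theta <= 1 ->
  0 <= f0 s <= f0 t -> 0 <= f1 s <= f1 t ->
  geo_mean theta f0 f1 s <= geo_mean theta f0 f1 t.
Proof.
move=> /andP[th0 th1] /andP[a0 ab] /andP[c0 cd].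
by rewrite ler_pM ?powR_ge0// ge0_ler_powR ?subr_ge0// ?nnegrE// (le_trans _ ab, le_trans _ cd).
Qed.

Let geo_mean_scale theta f0 f1 s t l : 0 <= theta <= 1 -> 0 <= l ->
  0 <= f0 s -> 0 <= f1 s -> 0 <= f0 t -> 0 <= f1 t ->
  (f0 t <= l * f0 s -> f1 t <= l * f1 s ->
    geo_mean theta f0 f1 t <= l * geo_mean theta f0 f1 s) /\
  (l * f0 s <= f0 t -> l * f1 s <= f1 t ->
    l * geo_mean theta f0 f1 s <= geo_mean theta f0 f1 t).
Proof.
move=> /andP[th0 th1] l0 a0 b0 c0 d0.
have -> : l * geo_mean theta f0 f1 s =
    (l * f0 s) `^ (1 - theta) * (l * f1 s) `^ theta.
  rewrite !powRM// mulrACA -powRD ?subrK ?powRr1//.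
  by rewrite oner_eq0.
split=> h0 h1; rewrite /geo_mean;
  by apply: ler_pM; rewrite ?powR_ge0// ge0_ler_powR ?subr_ge0// ?nnegrE// mulr_ge0.
Qed.

Let mbij_geo_mean theta f0 f1 : 0 <= theta <= 1 ->
  mbij f0 -> mbij f1 -> mbij (geo_mean theta f0 f1).
Proof.
move=> th b0 b1; have /andP[th0 th1] := th.
set h := geo_mean _ _ _.
have f0ge t : 0 <= t -> 0 <= f0 t by exact: mbij_ge0.
have f1ge t : 0 <= t -> 0 <= f1 t by exact: mbij_ge0.
have f0gt t : 0 < t -> 0 < f0 t.
  by move=> t0; rewrite -(mbij0 b0) (leW_mono_in (mbij_mono b0)) ?in0y// ltW.
have f1gt t : 0 < t -> 0 < f1 t.
  by move=> t0; rewrite -(mbij0 b1) (leW_mono_in (mbij_mono b1)) ?in0y// ltW.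
have hgt t : 0 < t -> 0 < h t by move=> t0; rewrite mulr_gt0 ?powR_gt0 ?f0gt ?f1gt.
have hge t : 0 <= h t by rewrite mulr_ge0 ?powR_ge0.
have hh : {in `[0, +oo[ &, {homo h : s t / s <= t}}.
  move=> s t; rewrite !in0y => s0 t0 st; apply: geo_mean_le => //.
  - by rewrite f0ge//= (mbij_mono b0) ?in0y.
  - by rewrite f1ge//= (mbij_mono b1) ?in0y.
have h0 : h 0 = 0.
  rewrite /h /geo_mean !mbij0//; have [->|/powR0 ->] := eqVneq theta 0.
    by rewrite subr0 powRr1// mul0r.
  by rewrite mulr0.
have hlt s t : 0 <= s -> s < t -> h s < h t.
  move=> s0 st; have t0 : 0 < t by exact: le_lt_trans st.
  have lt0 : f0 s < f0 t by rewrite (leW_mono_in (mbij_mono b0)) ?in0y// ltW.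
  have lt1 : f1 s < f1 t by rewrite (leW_mono_in (mbij_mono b1)) ?in0y// ltW.
  have [th00|th00] := eqVneq theta 0.
    by rewrite /h /geo_mean th00 subr0 !powRr0 !powRr1 ?mulr1 ?f0ge// ltW.
  apply: (@le_lt_trans _ _ (f0 t `^ (1 - theta) * f1 s `^ theta)).
    rewrite ler_wpM2r ?powR_ge0// ge0_ler_powR ?subr_ge0// ?nnegrE ?f0ge//; exact: ltW.
  rewrite ltr_pM2l ?powR_gt0 ?f0gt// gt0_ltr_powR ?nnegrE ?f1ge//; last exact: ltW.
  by rewrite lt_neqAle eq_sym th00.
split=> //; split.
- by move=> t _ /=; rewrite in0y.
- move=> s t; rewrite !inE/= !in0y => s0 t0 e.
  by case: (ltgtP s t) => // /hlt; [move=> /(_ s0)|move=> /(_ t0)]; rewrite e ltxx.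
move=> y /=; rewrite in0y le_eqVlt => /predU1P[<-|y0].
  by exists 0 => //=; rewrite in0y.
have g0ge u : 0 <= u -> 0 <= ginv f0 u by exact: mbij_ge0 (ginv_mbij b0).
have g1ge u : 0 <= u -> 0 <= ginv f1 u by exact: mbij_ge0 (ginv_mbij b1).
have yE : y = y `^ (1 - theta) * y `^ theta.
  by rewrite -powRD ?subrK ?powRr1// ?ltW// oner_eq0.
pose S := [set t | 0 <= t /\ h t <= y].
pose c := sup S.
have y0' := ltW y0.
pose b := Num.max (ginv f0 y) (ginv f1 y).
have b_ge0 : 0 <= b by rewrite le_max g0ge.
have hb : y <= h b.
  rewrite [leLHS]yE ler_pM ?powR_ge0// ge0_ler_powR ?subr_ge0// ?nnegrE// ?f0ge ?f1ge//.
  - by rewrite -[leLHS](ginvK b0 y0') (mbij_mono b0) ?in0y ?g0ge// le_max lexx.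
  - by rewrite -[leLHS](ginvK b1 y0') (mbij_mono b1) ?in0y ?g1ge// le_max lexx orbT.
have supS : has_sup S.
  split; first by exists 0; split=> //; rewrite h0.
  exists b => t [t0 hty]; rewrite leNgt; apply/negP => /(hlt _ _ b_ge0).
  by rewrite ltNge (le_trans hty).
have a_gt0 : 0 < Num.min (ginv f0 y) (ginv f1 y).
  rewrite lt_min !lt_neqAle g0ge// g1ge// !andbT; apply/andP; split.
    by apply: contraTneq y0 => e; rewrite -(ginvK b0 y0') -e mbij0 ?ltxx.
  by apply: contraTneq y0 => e; rewrite -(ginvK b1 y0') -e mbij0 ?ltxx.
have c0 : 0 < c.
  apply: (lt_le_trans a_gt0); apply: ub_le_sup; first by case: supS.
  split; first exact: ltW.
  rewrite [leRHS]yE ler_pM ?powR_ge0// ge0_ler_powR ?subr_ge0// ?nnegrE// ?f0ge ?f1ge ?(ltW a_gt0)//.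
  - by rewrite -[leRHS](ginvK b0 y0') (mbij_mono b0) ?in0y ?g0ge ?(ltW a_gt0)// ge_min lexx.
  - by rewrite -[leRHS](ginvK b1 y0') (mbij_mono b1) ?in0y ?g1ge ?(ltW a_gt0)// ge_min lexx orbT.
have cge := ltW c0.
have hc := hgt _ c0.
pose l := y / h c.
have l0 : 0 < l by rewrite divr_gt0.
have lhc : l * h c = y by rewrite /l divfK// gt_eqF.
have l0' := ltW l0.
have lf0 : 0 <= l * f0 c by rewrite mulr_ge0 ?f0ge.
have lf1 : 0 <= l * f1 c by rewrite mulr_ge0 ?f1ge.
exists c; first by rewrite /= in0y.
case: (ltgtP (h c) y) => // hcy; exfalso.
- have l1 : 1 < l by rewrite ltr_pdivlMr// mul1r.
  pose t := Num.min (ginv f0 (l * f0 c)) (ginv f1 (l * f1 c)).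
  have ct : c < t.
    rewrite lt_min; apply/andP; split.
      rewrite -(leW_mono_in (mbij_mono b0)) ?in0y ?g0ge// ginvK//.
      by rewrite ltr_pMl ?f0gt.
    rewrite -(leW_mono_in (mbij_mono b1)) ?in0y ?g1ge// ginvK//.
    by rewrite ltr_pMl ?f1gt.
  have t0 : 0 <= t by rewrite ltW// (lt_trans c0).
  have ht : h t <= y.
    rewrite -lhc; apply: (geo_mean_scale _ _ _ _ _ _).1 => //;
      rewrite ?f0ge ?f1ge//.
    - by rewrite -[leRHS](ginvK b0)// (mbij_mono b0) ?in0y ?g0ge// ge_min lexx.
    - by rewrite -[leRHS](ginvK b1)// (mbij_mono b1) ?in0y ?g1ge// ge_min lexx orbT.
  have : t <= c by apply: ub_le_sup; [case: supS|split].
  by rewrite leNgt ct.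
- have l1 : l < 1 by rewrite ltr_pdivrMr// mul1r.
  pose t := Num.max (ginv f0 (l * f0 c)) (ginv f1 (l * f1 c)).
  have t0 : 0 <= t by rewrite le_max g0ge.
  have tc : t < c.
    rewrite gt_max; apply/andP; split.
      rewrite -(leW_mono_in (mbij_mono b0)) ?in0y ?g0ge// ginvK//.
      by rewrite gtr_pMl ?f0gt.
    rewrite -(leW_mono_in (mbij_mono b1)) ?in0y ?g1ge// ginvK//.
    by rewrite gtr_pMl ?f1gt.
  have ht : y <= h t.
    rewrite -lhc; apply: (geo_mean_scale _ _ _ _ _ _).2 => //;
      rewrite ?f0ge ?f1ge//.
    - by rewrite -[leLHS](ginvK b0)// (mbij_mono b0) ?in0y ?g0ge// le_max lexx.
    - by rewrite -[leLHS](ginvK b1)// (mbij_mono b1) ?in0y ?g1ge// le_max lexx orbT.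
  have ct0 : 0 < c - t by rewrite subr_gt0.
  have [s [s0 hs]] := sup_adherent ct0 supS.
  rewrite -/c subKr => ts; have := hlt _ _ t0 ts.
  by rewrite ltNge (le_trans hs).
Qed.

Lemma invertible_growth_interp Phi0 Phi1 (theta : R) : 0 <= theta <= 1 ->
  invertible_growth Phi0 -> invertible_growth Phi1 ->
  invertible_growth (interp Phi0 Phi1 theta).
Proof.
move=> th /mbij_invertible b0 /mbij_invertible b1; apply/mbij_invertible.
by apply: ginv_mbij; apply: mbij_geo_mean => //; exact: ginv_mbij.
Qed.

Lemma ginv_interp Phi0 Phi1 (theta t : R) : 0 <= theta <= 1 ->
  invertible_growth Phi0 -> invertible_growth Phi1 -> 0 <= t ->
  ginv (interp Phi0 Phi1 theta) t =
  ginv Phi0 t `^ (1 - theta) * ginv Phi1 t `^ theta.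
Proof.
move=> th /mbij_invertible b0 /mbij_invertible b1 t0.
by rewrite ginv_ginv//; apply: mbij_geo_mean => //; exact: ginv_mbij.
Qed.

End well_defined.

(* Main.v *)
Require Import Defs.
From mathcomp Require Import all_boot all_order all_algebra.
From mathcomp Require Import all_classical all_reals all_analysis.
From mathcomp Require Import ring lra.

Import Order.TTheory GRing.Theory Num.Theory.
Import numFieldNormedType.Exports.

Local Open Scope classical_set_scope.
Local Open Scope ring_scope.

(** For a fixed [t], let [r_theta t] be the quotient ([Cmin_quotient]) whose
    supremum over [t] is [Cmin] of the pair with parameter [theta].  Real powers
    are multiplicative, so [r_theta t = r_0 t `^ (1 - theta) * r_1 t `^ theta]
    ([Cmin_interp]): every [r_theta t] is log-affine in [theta].  Each factor is
    bounded by the corresponding power of its own supremum, hence the supremum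
    of a geometric mean is at most the geometric mean of the suprema
    ([ereal_sup_geo_mean_le]); this is the first claim.

    The second claim is the same inequality applied between two arbitrary
    parameters [a] and [b] instead of [0] and [1]: the geometric mean of [r_a]
    and [r_b] with weight [s] is again [r_theta], with
    [theta = (1 - s) * a + s * b] ([geo_mean_geo_mean]).  Taking logarithms is
    legitimate because the suprema are positive, the quotients being so, and
    finite, by membership in [Fpairs] at the endpoints and by the first claim
    in between. *)

Lemma ginv_gt0 (R : realType) (Phi : R -> R) (t : R) :
  invertible_growth Phi -> 0 < t -> 0 < ginv Phi t.
Proof.
move=> [[_ _ Phi0 _] Phib] t0.
have [_ _ Phis] := Phib.
have tI : [set` `[0, +oo[] t by rewrite /= in_itv/= andbT ltW.
have gK : Phi (ginv Phi t) = t by apply: (surjpK _ Phis); rewrite inE.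
have [gI _ _] := bijpinv_bij (fun=> 0) Phib.
have g0 : 0 <= ginv Phi t by have := gI _ tI; rewrite /= in_itv/= andbT.
rewrite lt_neqAle g0 andbT; apply: contraTneq t0 => e.
by rewrite -gK -e Phi0 ltxx.
Qed.

Lemma conv_itv01 (R : realType) (p : {i01 R}) (a b : R) :
  0 <= a <= 1 -> 0 <= b <= 1 ->
  0 <= conv p (a : convex_lmodType R^o) b <= 1.
Proof.
move=> /andP[a0 a1] /andP[b0 b1].
have p0 : 0 <= p%:num by []; have p1 : p%:num <= 1 by [].
rewrite -[conv _ _ _]/(p%:num * a + (1 - p%:num) * b).
by apply/andP; split; nra.
Qed.

Section geo_mean_theory.
Variable R : realType.
Implicit Types (f g : R -> R) (theta s t : R).

Lemma geo_mean_gt0 theta f0 f1 t :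
  0 < f0 t -> 0 < f1 t -> 0 < geo_mean theta f0 f1 t.
Proof. by move=> f0t f1t; rewrite mulr_gt0 ?powR_gt0. Qed.

Lemma geo_mean_div theta f0 f1 g0 g1 t :
  0 <= f0 t -> 0 <= f1 t -> 0 <= g0 t -> 0 <= g1 t ->
  geo_mean theta (f0 \* (fun u => (g0 u)^-1)) (f1 \* (fun u => (g1 u)^-1)) t =
  geo_mean theta f0 f1 t / geo_mean theta g0 g1 t.
Proof.
move=> f0t f1t g0t g1t; rewrite /geo_mean /= !powRM ?invr_ge0//.
have powV (x r : R) : 0 <= x -> x^-1 `^ r = (x `^ r)^-1.
  by move=> x0; rewrite -powRN -powR_inv1// -powRrM mulN1r.
by rewrite !powV// invfM mulrACA.
Qed.

(** On a log scale [theta |-> geo_mean theta f0 f1 t] parametrises a segment,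
    and a weighted mean of two points of that segment is the point at the
    weighted mean of their parameters. *)
Lemma geo_mean_geo_mean s a b f0 f1 t : 0 < f0 t -> 0 < f1 t ->
  geo_mean s (geo_mean a f0 f1) (geo_mean b f0 f1) t =
  geo_mean ((1 - s) * a + s * b) f0 f1 t.
Proof.
move=> f0t f1t; rewrite /geo_mean !powRM ?powR_ge0// -!powRrM mulrACA.
rewrite -!powRD ?(gt_eqF f0t) ?(gt_eqF f1t) ?implybT//.
by congr (_ `^ _ * _ `^ _); ring.
Qed.

(** Powers with a nonnegative exponent are monotone on [0, +oo], so each factor
    is bounded separately.  This covers infinite suprema: with exponent [0] both
    the factor and the power of [+oo] that bounds it are [1]. *)
Lemma ereal_sup_geo_mean_le (D : set R) theta f0 f1 : 0 <= theta <= 1 ->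
  (forall t, D t -> 0 <= f0 t) -> (forall t, D t -> 0 <= f1 t) ->
  (ereal_sup [set (geo_mean theta f0 f1 t)%:E | t in D] <=
   ereal_sup [set (f0 t)%:E | t in D] `^ (1 - theta) *
   ereal_sup [set (f1 t)%:E | t in D] `^ theta)%E.
Proof.
move=> /andP[th0 th1] f0D f1D; apply: ge_ereal_sup => _ [t Dt <-].
have pow_le f r : 0 <= r -> (forall u, D u -> 0 <= f u) ->
    ((f t `^ r)%:E <= ereal_sup [set (f u)%:E | u in D] `^ r)%E.
  move=> r0 fD; rewrite -poweR_EFin.
  have ft : ((f t)%:E <= ereal_sup [set (f u)%:E | u in D])%E.
    by apply: ereal_sup_ubound; exists t.
  have ft0 : (0 <= (f t)%:E)%E by rewrite lee_fin fD.
  by apply: gt0_ler_poweR => //; rewrite in_itv/= leey andbT// (le_trans ft0).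
by rewrite EFinM lee_pmul ?lee_fin ?powR_ge0// pow_le ?subr_ge0.
Qed.

Lemma ln_fine_le_of_le_geo s (x y z : \bar R) :
  (0 < x < +oo)%E -> (0 < y < +oo)%E -> (0 < z < +oo)%E ->
  (z <= x `^ (1 - s) * y `^ s)%E ->
  ln (fine z) <= (1 - s) * ln (fine x) + s * ln (fine y).
Proof.
have posE (u : \bar R) : (0 < u < +oo)%E -> exists2 r : R, 0 < r & u = r%:E.
  by case: u => [r| |]; rewrite ?ltxx ?andbF//= lte_fin => /andP[]; exists r.
move=> /posE[{}x x0 ->] /posE[{}y y0 ->] /posE[{}z z0 ->].
rewrite -EFinM lee_fin /= => zle.
rewrite -!ln_powR -lnM ?posrE ?powR_gt0//.
by rewrite ler_ln ?posrE ?mulr_gt0 ?powR_gt0.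
Qed.

Lemma ln_ereal_sup_geo_mean_convex (D : set R) f0 f1 : D !=set0 ->
  (forall t, D t -> 0 < f0 t) -> (forall t, D t -> 0 < f1 t) ->
  (ereal_sup [set (f0 t)%:E | t in D] < +oo)%E ->
  (ereal_sup [set (f1 t)%:E | t in D] < +oo)%E ->
  @convex_function R R^o `[0, 1]%classic (fun theta : R =>
    ln (fine (ereal_sup [set (geo_mean theta f0 f1 t)%:E | t in D]))).
Proof.
move=> [t0 Dt0] f0D f1D sup0 sup1.
pose S theta := ereal_sup [set (geo_mean theta f0 f1 t)%:E | t in D].
have f0D' t : D t -> 0 <= f0 t by move/f0D/ltW.
have f1D' t : D t -> 0 <= f1 t by move/f1D/ltW.
have S_gt0 theta : (0 < S theta)%E.
  apply: (@lt_le_trans _ _ (geo_mean theta f0 f1 t0)%:E).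
    by rewrite lte_fin geo_mean_gt0 ?f0D ?f1D.
  by apply: ereal_sup_ubound; exists t0.
have S_lty theta : 0 <= theta <= 1 -> (S theta < +oo)%E.
  move=> th; apply: le_lt_trans (ereal_sup_geo_mean_le _ _ _ _ _ _ _) _ => //.
  by rewrite lte_mul_pinfty ?poweR_ge0 ?poweR_lty // ge0_fin_numE ?poweR_ge0 ?poweR_lty.
have S_pos_fin theta : 0 <= theta <= 1 -> (0 < S theta < +oo)%E.
  by move=> th; rewrite S_gt0 S_lty.
have lnS s a b : 0 <= s <= 1 -> 0 <= a <= 1 -> 0 <= b <= 1 ->
    0 <= (1 - s) * a + s * b <= 1 ->
    ln (fine (S ((1 - s) * a + s * b))) <=
    (1 - s) * ln (fine (S a)) + s * ln (fine (S b)).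
  move=> sI aI bI cI; apply: ln_fine_le_of_le_geo; rewrite ?S_pos_fin//.
  rewrite [leLHS](_ : _ = ereal_sup
      [set (geo_mean s (geo_mean a f0 f1) (geo_mean b f0 f1) t)%:E | t in D]).
    by apply: ereal_sup_geo_mean_le => // t Dt; rewrite mulr_ge0 ?powR_ge0.
  congr ereal_sup; apply: eq_imagel => t Dt.
  by rewrite geo_mean_geo_mean ?f0D ?f1D.
(* [p] is the weight of the first point in a convex combination, whereas
   [s] is the weight of the second function in [geo_mean]. *)
move=> p a b; rewrite !inE/= !in_itv/= => aI bI.
have := lnS (1 - p%:num) a b _ aI bI; rewrite subKr; apply.
- by rewrite subr_ge0 gerBl ge0 le1.
- exact: conv_itv01 _ p a b aI bI.
Qed.

End geo_mean_theory.

Definition Cmin_quotient {R : realType} (alpha beta : R) (Phi Psi : R -> R) :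
    R -> R :=
  fun t => ginv Phi (t `^ (2 + alpha)) / ginv Psi (t `^ (2 + beta)).

Lemma Cmin_quotient_gt0 (R : realType) (alpha beta : R) (Phi Psi : R -> R) t :
  invertible_growth Phi -> invertible_growth Psi -> 0 < t ->
  0 < Cmin_quotient alpha beta Phi Psi t.
Proof. by move=> hPhi hPsi t0; rewrite divr_gt0 ?ginv_gt0 ?powR_gt0. Qed.

Lemma Cmin_lty (R : realType) (alpha beta : R) (Phi Psi : R -> R) :
  Fpairs alpha beta (Phi, Psi) -> (Cmin alpha beta Phi Psi < +oo)%E.
Proof.
move=> [/= hPhi hPsi [C C0 hC]].
apply: (@le_lt_trans _ _ C%:E); last exact: ltry.
apply: ge_ereal_sup => _ [t /= + <-]; rewrite in_itv/= andbT => t0.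
by rewrite lee_fin ler_pdivrMr ?hC// ginv_gt0 ?powR_gt0.
Qed.

Lemma Cmin_interp (R : realType) (alpha beta theta : R)
    (Phi0 Psi0 Phi1 Psi1 : R -> R) : 0 <= theta <= 1 ->
  invertible_growth Phi0 -> invertible_growth Psi0 ->
  invertible_growth Phi1 -> invertible_growth Psi1 ->
  Cmin alpha beta (interp Phi0 Phi1 theta) (interp Psi0 Psi1 theta) =
  ereal_sup [set (geo_mean theta (Cmin_quotient alpha beta Phi0 Psi0)
                                 (Cmin_quotient alpha beta Phi1 Psi1) t)%:E
            | t in `]0, +oo[].
Proof.
move=> th hPhi0 hPsi0 hPhi1 hPsi1; congr ereal_sup.
apply: eq_imagel => t /=; rewrite in_itv/= andbT => t0.
rewrite !ginv_interp ?powR_ge0//; congr EFin.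
rewrite -[LHS](geo_mean_div _ theta
  (fun u => ginv Phi0 (u `^ (2 + alpha))) (fun u => ginv Phi1 (u `^ (2 + alpha)))
  (fun u => ginv Psi0 (u `^ (2 + beta))) (fun u => ginv Psi1 (u `^ (2 + beta))))//;
  by rewrite ltW// ginv_gt0 ?powR_gt0.
Qed.

Theorem corollary2 (R : realType) (alpha beta : R)
    (halpha : -1 <= alpha) (hbeta : -1 <= beta)
    (Phi0 Psi0 Phi1 Psi1 : R -> R)
    (h0 : Fpairs alpha beta (Phi0, Psi0))
    (h1 : Fpairs alpha beta (Phi1, Psi1)) :
  (forall theta : R, 0 <= theta <= 1 ->
    (Cmin alpha beta (interp Phi0 Phi1 theta) (interp Psi0 Psi1 theta)
     <= Cmin alpha beta Phi0 Psi0 `^ (1 - theta)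
        * Cmin alpha beta Phi1 Psi1 `^ theta)%E) /\
  @convex_function R R^o `[0, 1]%classic (fun theta : R =>
    ln (fine (Cmin alpha beta (interp Phi0 Phi1 theta)
                              (interp Psi0 Psi1 theta)))).
Proof.
have Cfin0 := Cmin_lty _ _ _ _ _ h0; have Cfin1 := Cmin_lty _ _ _ _ _ h1.
have [/= hPhi0 hPsi0 _] := h0; have [/= hPhi1 hPsi1 _] := h1.
have q0_gt0 t : [set` `]0, +oo[] t -> 0 < Cmin_quotient alpha beta Phi0 Psi0 t.
  by rewrite /= in_itv/= andbT; exact: Cmin_quotient_gt0.
have q1_gt0 t : [set` `]0, +oo[] t -> 0 < Cmin_quotient alpha beta Phi1 Psi1 t.
  by rewrite /= in_itv/= andbT; exact: Cmin_quotient_gt0.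
split=> [theta th|].
  rewrite Cmin_interp//; apply: ereal_sup_geo_mean_le => // t tI; apply: ltW.
  - exact: q0_gt0.
  - exact: q1_gt0.
have D0 : ([set` `]0, +oo[] : set R) !=set0 by exists 1; rewrite /= in_itv/= ltr01.
have cvx := ln_ereal_sup_geo_mean_convex _ _ _ _ D0 q0_gt0 q1_gt0 Cfin0 Cfin1.
(* [Cmin_interp] only identifies the two functions on [0, 1], so it must be
   used at the three points of a convexity inequality. *)
move=> p a b aI bI; have := cvx p a b aI bI.
move: aI bI; rewrite !inE/= !in_itv/= => aI bI.
by rewrite !Cmin_interp// conv_itv01.
Qed.
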